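(* (Completeness.) Let $\mathcal F\subseteq\mathsf{Form}$ be a finite set of possibilistic formulas and $(\gamma;\,y)\in\mathsf{Form}$. If $\mathcal F\models(\gamma;\,y)$, then $\mathcal F\vdash(\gamma;\,y)$.
   Context: Let $V$ be a denumerable set of propositional variables and let $\mathcal L$ be the set of formulas generated inductively from $V$ by the binary connectives $\land,\lor,\to$ and the unary connectives $\neg,\circ$. An $\mathbf{mbCiw}$-valuation is a function $v:\mathcal L\to\{0,1\}$ such that for all $\alpha,\beta\in\mathcal L$: (1) $v(\alpha\land\beta)=1$ iff $v(\alpha)=1$ and $v(\beta)=1$; (2) $v(\alpha\lor\beta)=1$ iff $v(\alpha)=1$ or $v(\beta)=1$; (3) $v(\alpha\to\beta)=1$ iff $v(\alpha)=0$ or $v(\beta)=1$; (4) $v(\neg\alpha)=0$ implies $v(\alpha)=1$; (5) $v(\circ\alpha)=1$ iff $v(\alpha)=0$ or $v(\neg\alpha)=0$. Let $\mathsf{Val}$ be the set of all $\mathbf{mbCiw}$-valuations. Infima and suprema are taken in $[0,1]$, with the convention $\inf\emptyset=1$ and $\sup\emptyset=0$. A possibilistic formula is a pair $(\varphi;\,x)$ with $\varphi\in\mathcal L$ and $x\in(0,1]$; $\mathsf{Form}$ is the set of all possibilistic formulas. Semantics. A possibility distribution is any map $\pi:\mathsf{Val}\to[0,1]$. The necessity measure induced by $\pi$ is $N:\mathcal L\to[0,1]$, $N(\varphi)=\inf\{1-\pi(w)\mid w\in\mathsf{Val},\ w(\varphi)=0\}$. We write $\pi\models(\varphi;\,x)$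 iff $N(\varphi)\ge x$; $\pi\models\mathcal F$ iff $\pi\models\Phi$ for all $\Phi\in\mathcal F$; and $\mathcal F\models\Phi$ iff every possibility distribution $\pi$ with $\pi\models\mathcal F$ satisfies $\pi\models\Phi$. Proof system. The axioms are all possibilistic formulas $(\chi;\,1)$ where $\chi$ is an instance (with $\alpha,\beta,\gamma\in\mathcal L$ arbitrary) of one of: (i) $\alpha\to(\beta\to\alpha)$; (ii) $(\alpha\to(\beta\to\gamma))\to((\alpha\to\beta)\to(\alpha\to\gamma))$; (iii) $\alpha\to(\beta\to(\alpha\land\beta))$; (iv) $(\alpha\land\beta)\to\alpha$; (v) $(\alpha\land\beta)\to\beta$; (vi) $\alpha\to(\alpha\lor\beta)$; (vii) $\beta\to(\alpha\lor\beta)$; (viii) $(\alpha\to\gamma)\to((\beta\to\gamma)\to((\alpha\lor\beta)\to\gamma))$; (ix) $(\alpha\to\beta)\lor\alpha$; (x) $\alpha\lor\neg\alpha$; (xi) $\circ\alpha\to(\alpha\to(\neg\alpha\to\beta))$; (xii) $\circ\alpha\lor(\alpha\land\neg\alpha)$. The inference rules are: [GMP] from $(\alpha;\,x)$ and $(\alpha\to\beta;\,y)$ infer $(\beta;\,\min\{x,y\})$; [S] from $(\alpha;\,x)$ infer $(\alpha;\,y)$ for any $y\in(0,1]$ with $y\le x$. A derivation of $\Phi$ from $\mathcal F$ is a finite sequence $(\Phi_1,\dots,\Phi_n)$ in $\mathsf{Form}$ with $\Phi_n=\Phi$, each $\Phi_i$ being an axiom instance, or an element of $\mathcal F$, or obtained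 from earlier elements of the sequence by GMP or S. We write $\mathcal F\vdash\Phi$ if there is a derivation of $\Phi$ from $\mathcal F$. *)

(* Defs.v *)
From HB Require Import structures.
From mathcomp Require Import all_boot all_order all_algebra.
From mathcomp Require Import all_classical all_reals.
From mathcomp Require Import interval_inference.

Set Implicit Arguments.
Unset Strict Implicit.
Unset Printing Implicit Defensive.

Import Order.TTheory GRing.Theory Num.Theory.

Local Open Scope classical_set_scope.
Local Open Scope ring_scope.

Inductive formula (V : Type) : Type :=
| Var of V
| And of formula V & formula V
| Or of formula V & formula V
| Imp of formula V & formula V
| Neg of formula V
| Circ of formula V.

Declare Scope mbC_scope.
Delimit Scope mbC_scope with mbC.
Bind Scope mbC_scope with formula.

Notation "∘ a" := (Circ a) (at level 35, right associativity) : mbC_scope.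
Notation "¬ a" := (Neg a) (at level 35, right associativity) : mbC_scope.
Notation "a ∧ b" := (And a b) (at level 40, left associativity) : mbC_scope.
Notation "a ∨ b" := (Or a b) (at level 50, left associativity) : mbC_scope.
Notation "a ⊃ b" := (Imp a b) (at level 55, right associativity) : mbC_scope.

(* The truth values 0 and 1 are [false] and [true]. *)
Record mbCiw_valuation (V : Type) (v : formula V -> bool) : Prop := {
  val_and : forall a b, v (a ∧ b)%mbC = true <-> v a = true /\ v b = true;
  val_or : forall a b, v (a ∨ b)%mbC = true <-> v a = true \/ v b = true;
  val_imp : forall a b, v (a ⊃ b)%mbC = true <-> v a = false \/ v b = true;
  val_neg : forall a, v (¬ a)%mbC = false -> v a = true;
  val_circ : forall a,
    v (∘ a)%mbC = true <-> v a = false \/ v (¬ a)%mbC = false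
}.

Definition Val (V : Type) : Type :=
  {v : formula V -> bool | mbCiw_valuation v}.

Definition pformula (V : Type) (R : realType) : Type :=
  (formula V * {itv R & `]0, 1]})%type.

Definition fml (V : Type) (R : realType) (Phi : pformula V R) : formula V :=
  Phi.1.

Definition deg (V : Type) (R : realType) (Phi : pformula V R) : R :=
  Phi.2%:num.

(* Infimum in the lattice [0, 1]; the library's [inf] of [set0] is 0. *)
Definition inf01 (R : realType) (A : set R) : R :=
  if A == set0 then 1 else inf A.

Definition possibility (V : Type) (R : realType) : Type := Val V -> {i01 R}.

Definition necessity (V : Type) (R : realType) (pi : possibility V R)
    (a : formula V) : R :=
  inf01 [set 1 - (pi w)%:num | w in [set w : Val V | sval w a = false]].

Lemma necessity01 (V : Type) (R : realType) (pi : possibility V R)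
    (a : formula V) : 0 <= necessity pi a <= 1.
Proof.
rewrite /necessity /inf01; case: ifPn; first by rewrite ler01 lexx.
case/set0P => x hx; apply/andP; split.
  by apply: lb_le_inf; [exists x | move=> _ [w _ <-]; rewrite subr_ge0].
apply: (le_trans (y := x)); last by case: hx => w _ <-; rewrite gerBl.
by apply: ge_inf => //; exists 0 => _ [w _ <-]; rewrite subr_ge0.
Qed.

Definition sat (V : Type) (R : realType) (pi : possibility V R)
    (Phi : pformula V R) : Prop :=
  deg Phi <= necessity pi (fml Phi).

Definition sat_set (V : Type) (R : realType) (pi : possibility V R)
    (F : set (pformula V R)) : Prop :=
  forall Phi, F Phi -> sat pi Phi.

Definition entails (V : Type) (R : realType) (F : set (pformula V R))
    (Phi : pformula V R) : Prop :=
  forall pi : possibility V R, sat_set pi F -> sat pi Phi.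

Inductive mbCiw_axiom (V : Type) : formula V -> Prop :=
| ax_K a b : mbCiw_axiom (a ⊃ (b ⊃ a))
| ax_S a b c : mbCiw_axiom ((a ⊃ (b ⊃ c)) ⊃ ((a ⊃ b) ⊃ (a ⊃ c)))
| ax_andI a b : mbCiw_axiom (a ⊃ (b ⊃ (a ∧ b)))
| ax_andE1 a b : mbCiw_axiom ((a ∧ b) ⊃ a)
| ax_andE2 a b : mbCiw_axiom ((a ∧ b) ⊃ b)
| ax_orI1 a b : mbCiw_axiom (a ⊃ (a ∨ b))
| ax_orI2 a b : mbCiw_axiom (b ⊃ (a ∨ b))
| ax_orE a b c : mbCiw_axiom ((a ⊃ c) ⊃ ((b ⊃ c) ⊃ ((a ∨ b) ⊃ c)))
| ax_peirce a b : mbCiw_axiom ((a ⊃ b) ∨ a)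
| ax_em a : mbCiw_axiom (a ∨ ¬ a)
| ax_bc a b : mbCiw_axiom (∘ a ⊃ (a ⊃ (¬ a ⊃ b)))
| ax_ciw a : mbCiw_axiom (∘ a ∨ (a ∧ ¬ a)).

Definition paxiom (V : Type) (R : realType) (Phi : pformula V R) : Prop :=
  mbCiw_axiom (fml Phi) /\ deg Phi = 1.

Definition gmp (V : Type) (R : realType) (Phi Psi Xi : pformula V R) : Prop :=
  fml Psi = Imp (fml Phi) (fml Xi) /\ deg Xi = Num.min (deg Phi) (deg Psi).

Definition weakening (V : Type) (R : realType) (Phi Xi : pformula V R) : Prop :=
  fml Xi = fml Phi /\ deg Xi <= deg Phi.

Definition is_derivation (V : Type) (R : realType) (F : set (pformula V R))
    (Phi : pformula V R) (n : nat) (s : 'I_n.+1 -> pformula V R) : Prop :=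
  s ord_max = Phi /\
  forall i : 'I_n.+1,
    [\/ paxiom (s i),
        F (s i),
        exists j k : 'I_n.+1, [/\ (j < i)%N, (k < i)%N & gmp (s j) (s k) (s i)]
      | exists j : 'I_n.+1, (j < i)%N /\ weakening (s j) (s i)].

Definition derivable (V : Type) (R : realType) (F : set (pformula V R))
    (Phi : pformula V R) : Prop :=
  exists (n : nat) (s : 'I_n.+1 -> pformula V R), is_derivation F Phi s.

(* Main.v *)
Require Import Defs.
From mathcomp Require Import all_boot all_order all_algebra.
From mathcomp Require Import all_classical all_reals.
From mathcomp Require Import interval_inference.

(** The possibilistic statement reduces to completeness of the crisp logic at
    the level [y], because the cut [y_cut F y] of formulas believed at least
    to degree [y] decides both sides.

    If every mbCiw-valuation satisfying the cut satisfies [g], then the crisp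
    Hilbert calculus proves [g] from the cut ([proves_complete]), and this
    proof, annotated with the constant degree [y], is a possibilistic
    derivation: hypotheses and axioms are weakened to [y], and modus ponens
    keeps the degree since the minimum of [y] and [y] is [y]
    ([derivable_of_proves]).

    Otherwise some valuation [w] satisfies the cut and refutes [g]. Concentrate
    all possibility on [w], giving it [1 - m], where [m < y] bounds the degrees
    of the members of [F] outside the cut; such an [m] exists because [F] is
    finite. A formula true under [w] then has necessity [1], and a formula
    false under [w] has necessity [m]: every member of [F] holds, yet [g] has
    necessity [m < y], against the entailment.

    Crisp completeness is the Lindenbaum argument: among the supersets of the
    hypotheses that do not prove [g] a maximal one exists by Zorn's lemma, as
    proofs are finite ([proves_bigcup]). It is closed under provability, and by
    the deduction theorem [g] follows in it from any formula outside it
    ([saturated]), so a disjunction belongs to it only if a disjunct does.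
    Each clause of the definition of a valuation then follows from the axioms
    for its connective ([saturated_valuation]). *)

Import Order.TTheory GRing.Theory Num.Theory.

Local Open Scope classical_set_scope.
Local Open Scope ring_scope.

(** * The crisp Hilbert calculus *)

Inductive proves {V : Type} (G : set (formula V)) : formula V -> Prop :=
| proves_axiom {a} : mbCiw_axiom a -> proves G a
| proves_hyp {a} : G a -> proves G a
| proves_mp {a b} : proves G a -> proves G (a ⊃ b)%mbC -> proves G b.

Lemma proves_mono {V : Type} {G H : set (formula V)} {a : formula V} :
  G `<=` H -> proves G a -> proves H a.
Proof.
move=> GH; elim=> [b ax|b Gb|b c _ IHb _ IHbc].
- exact: proves_axiom.
- exact/proves_hyp/GH.
- exact: proves_mp IHb IHbc.
Qed.

Lemma proves_ax_mp {V : Type} {G : set (formula V)} {a b : formula V} :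
  mbCiw_axiom (a ⊃ b)%mbC -> proves G a -> proves G b.
Proof. by move=> ax Ga; apply: proves_mp Ga (proves_axiom _ ax). Qed.

Lemma proves_ax_mp2 {V : Type} {G : set (formula V)} {a b c : formula V} :
  mbCiw_axiom (a ⊃ (b ⊃ c))%mbC -> proves G a -> proves G b -> proves G c.
Proof. by move=> ax Ga Gb; apply: proves_mp Gb (proves_ax_mp ax Ga). Qed.

Lemma deduction {V : Type} {G : set (formula V)} {a b : formula V} :
  proves (a |` G) b -> proves G (a ⊃ b)%mbC.
Proof.
elim=> [c ax|c [->|Gc]|c d _ IHc _ IHcd].
- exact: proves_ax_mp (ax_K _ _) (proves_axiom _ ax).
- (* a ⊃ a, from S and K in the familiar SKK fashion *)
  apply: (@proves_ax_mp2 _ _ (a ⊃ ((a ⊃ a) ⊃ a))%mbC (a ⊃ (a ⊃ a))%mbC).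
  + exact: ax_S.
  + exact/proves_axiom/ax_K.
  + exact/proves_axiom/ax_K.
- exact: proves_ax_mp (ax_K _ _) (proves_hyp _ Gc).
- exact: proves_ax_mp2 (ax_S _ _ _) IHcd IHc.
Qed.

(** Compactness, in the form needed for chains: a proof uses finitely many
    hypotheses, so one member of the chain contains them all. The fixed part
    [G] takes care of the empty chain. *)
Lemma proves_bigcup {V : Type} {G : set (formula V)}
    {C : set (set (formula V))} {a : formula V} :
  total_on C subset -> proves (G `|` \bigcup_(X in C) X) a ->
  proves G a \/ exists2 X, C X & proves (G `|` X) a.
Proof.
move=> totC; elim=> [b ax|b [Gb|[X CX Xb]]|b c _ IHb _ IHbc].
- by left; exact: proves_axiom.
- by left; exact: proves_hyp.
- by right; exists X => //; apply: proves_hyp; right.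
case: IHb => [Gb|[X CX Xb]]; case: IHbc => [Gbc|[Y CY Ybc]].
- by left; exact: proves_mp Gb Gbc.
- right; exists Y => //; apply: proves_mp Ybc.
  by apply: proves_mono Gb; exact: subsetUl.
- right; exists X => //; apply: proves_mp Xb _.
  by apply: proves_mono Gbc; exact: subsetUl.
- case: (totC X Y CX CY) => [XY|YX].
  + right; exists Y => //; apply: proves_mp Ybc.
    by apply: proves_mono Xb; exact: setUS.
  + right; exists X => //; apply: proves_mp Xb _.
    by apply: proves_mono Ybc; exact: setUS.
Qed.

(** * Completeness of the crisp calculus *)

(** The two properties of a maximal set not proving [g] that the construction
    of a valuation uses. *)
Record saturated {V : Type} (g : formula V) (D : set (formula V)) : Prop := {
  saturated_unprovable : ~ proves D g;
  saturated_refutes : forall a, ~ D a -> proves D (a ⊃ g)%mbC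
}.

Lemma lindenbaum {V : Type} {G : set (formula V)} {g : formula V} :
  ~ proves G g -> exists2 D, G `<=` D & saturated g D.
Proof.
move=> nGg.
have [C CP totC|X [nXg maxX]] :=
    @Zorn_bigcup _ [set X | ~ proves (G `|` X) g].
  by move=> /(proves_bigcup totC)[//|[X CX]]; exact: CP.
exists (G `|` X); first exact: subsetUl.
split=> // a nDa; apply: deduction; apply: contrapT => nag.
apply: (maxX (a |` X)); last by rewrite /= setUCA.
split; first exact: subsetUr.
by move=> /(_ a (or_introl erefl)) Xa; apply: nDa; right.
Qed.

Lemma saturated_closed {V : Type} {g : formula V} {D : set (formula V)}
    {a : formula V} : saturated g D -> proves D a -> D a.
Proof.
move=> [nDg Dg] Da; apply: contrapT => /Dg Dag.
by apply: nDg; exact: proves_mp Da Dag.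
Qed.

Lemma saturated_or {V : Type} {g : formula V} {D : set (formula V)}
    {a b : formula V} : saturated g D -> proves D (a ∨ b)%mbC -> D a \/ D b.
Proof.
move=> [nDg Dg] Dab; apply: contrapT => /not_orP[/Dg Dag /Dg Dbg].
apply: nDg; apply: proves_mp Dab _.
exact: proves_ax_mp2 (ax_orE _ _ _) Dag Dbg.
Qed.

(** Truth is membership. A clause whose premise is that some formula is false
    has no introduction axiom of the form of an implication; there primeness
    applied to one of the disjunctive axioms [ax_peirce], [ax_em], [ax_ciw]
    turns non-membership of one disjunct into membership of the other. *)
Lemma saturated_valuation {V : Type} {g : formula V} {D : set (formula V)} :
  saturated g D -> mbCiw_valuation (fun a => `[< D a >]).
Proof.
move=> satD; have hyp a : D a -> proves D a by exact: proves_hyp.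
have cl a : proves D a -> D a by exact: saturated_closed satD.
have nd a : `[< D a >] = false <-> ~ D a.
  by split=> [/negbT/asboolPn|/asboolPn/negbTE].
have td a : `[< D a >] = true <-> D a by split=> /asboolP.
split=> [a b|a b|a b|a|a]; rewrite ?td ?nd.
- split=> [/hyp Dab|[/hyp Da /hyp Db]].
    by split; apply: cl;
      [exact: proves_ax_mp (ax_andE1 _ _) Dab
      |exact: proves_ax_mp (ax_andE2 _ _) Dab].
  exact/cl/(proves_ax_mp2 (ax_andI _ _) Da Db).
- split=> [/hyp|[/hyp Da|/hyp Db]]; first exact: saturated_or satD.
    exact/cl/(proves_ax_mp (ax_orI1 _ _) Da).
  exact/cl/(proves_ax_mp (ax_orI2 _ _) Db).
- split=> [/hyp Dab|[nDa|/hyp Db]].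
  + have [Da|] := pselect (D a); last by left.
    by right; apply/cl/(proves_mp _ (hyp _ Da) Dab).
  + by have [|//] := saturated_or satD (proves_axiom _ (ax_peirce a b)).
  + exact/cl/(proves_ax_mp (ax_K _ _) Db).
- by move=> nDna; have [] := saturated_or satD (proves_axiom _ (ax_em a)).
- split=> [/hyp Dca|nDana].
    apply/not_andP => -[/hyp Da /hyp Dna].
    apply: (saturated_unprovable _ _ satD); apply: proves_mp Dna _.
    exact: proves_ax_mp2 (ax_bc _ _) Dca Da.
  have [//|/hyp Dana] := saturated_or satD (proves_axiom _ (ax_ciw a)).
  case: nDana => [nDa|nDna].
    by case: nDa; apply: cl; exact: proves_ax_mp (ax_andE1 _ _) Dana.
  by case: nDna; apply: cl; exact: proves_ax_mp (ax_andE2 _ _) Dana.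
Qed.

Lemma proves_complete {V : Type} {G : set (formula V)} {g : formula V} :
  (forall w : Val V, (forall a, G a -> sval w a = true) -> sval w g = true) ->
  proves G g.
Proof.
move=> Gg; apply: contrapT => /lindenbaum[D GD satD].
have := Gg (exist _ _ (saturated_valuation satD)) => /= Dg.
apply: (saturated_unprovable _ _ satD); apply: proves_hyp.
by apply/asboolP/Dg => a /GD Da; exact/asboolP.
Qed.

(** * From crisp proofs to possibilistic derivations *)

Definition justified {V : Type} {R : realType} (F : set (pformula V R))
    (s : nat -> pformula V R) (i : nat) : Prop :=
  [\/ paxiom (s i),
      F (s i),
      exists j k : nat, [/\ (j < i)%N, (k < i)%N & gmp (s j) (s k) (s i)]
    | exists j : nat, (j < i)%N /\ weakening (s j) (s i)].

(** Sequences are total functions on [nat] read up to a length, which lets them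
    grow without changing type. *)
Definition derives {V : Type} {R : realType} (F : set (pformula V R))
    (s : nat -> pformula V R) (n : nat) : Prop :=
  forall i, (i < n)%N -> justified F s i.

Lemma derivable_of_derives {V : Type} {R : realType} {F : set (pformula V R)}
    {s : nat -> pformula V R} {n i : nat} :
  derives F s n -> (i < n)%N -> derivable F (s i).
Proof.
move=> Fs ltin; exists i, (fun j : 'I_i.+1 => s j); split=> // j.
have ltji := ltn_ord j.
have [ax|Fj|[k [l [ltkj ltlj mp]]]|[k [ltkj wk]]] :=
    Fs j (leq_trans ltji ltin).
- exact: Or41.
- exact: Or42.
- apply: Or43; exists (Ordinal (ltn_trans ltkj ltji)).
  by exists (Ordinal (ltn_trans ltlj ltji)).
- by apply: Or44; exists (Ordinal (ltn_trans ltkj ltji)).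
Qed.

Lemma justified_ext {V : Type} {R : realType} {F : set (pformula V R)}
    {s t : nat -> pformula V R} {i : nat} :
  (forall j, (j <= i)%N -> t j = s j) -> justified F s i -> justified F t i.
Proof.
move=> ts [ax|Fi|[k [l [ltki ltli mp]]]|[k [ltki wk]]].
- by apply: Or41; rewrite ts.
- by apply: Or42; rewrite ts.
- by apply: Or43; exists k, l; rewrite !ts // ltnW.
- by apply: Or44; exists k; rewrite !ts // ltnW.
Qed.

Definition append {T : Type} (s : nat -> T) (n : nat) (x : T) : nat -> T :=
  fun i => if i == n then x else s i.

Lemma append_last {T : Type} (s : nat -> T) (n : nat) (x : T) :
  append s n x n = x.
Proof. by rewrite /append eqxx. Qed.

Lemma append_lt {T : Type} {s : nat -> T} {n i : nat} (x : T) :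
  (i < n)%N -> append s n x i = s i.
Proof. by rewrite /append; case: ltngtP. Qed.

Lemma derives_append {V : Type} {R : realType} {F : set (pformula V R)}
    {s : nat -> pformula V R} {n : nat} {Phi : pformula V R} :
  derives F s n -> justified F (append s n Phi) n ->
  derives F (append s n Phi) n.+1.
Proof.
move=> Fs jn i; rewrite ltnS leq_eqVlt => /predU1P[->//|ltin].
apply: justified_ext (Fs i ltin) => j leji.
exact/append_lt/(leq_ltn_trans leji).
Qed.

(** Quantifying over the starting derivation makes derivations compose by
    extension, with no concatenation and renumbering: after extending to reach
    one premise, one extends the result to reach the other. *)
Definition reachable {V : Type} {R : realType} (F : set (pformula V R))
    (Phi : pformula V R) : Prop :=
  forall s n, derives F s n -> exists t m, [/\ derives F t m, (n <= m)%N,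
    forall i, (i < n)%N -> t i = s i & exists2 i, (i < m)%N & t i = Phi].

Lemma reachable_line {V : Type} {R : realType} {F : set (pformula V R)}
    {Phi : pformula V R} :
  (forall s n, s n = Phi -> justified F s n) -> reachable F Phi.
Proof.
move=> jPhi s n Fs; exists (append s n Phi), n.+1; split=> //.
- by apply: derives_append => //; apply: jPhi; rewrite append_last.
- by move=> i ltin; rewrite append_lt.
- by exists n => //; rewrite append_last.
Qed.

Lemma reachable_weakening {V : Type} {R : realType} {F : set (pformula V R)}
    {Phi Xi : pformula V R} :
  weakening Phi Xi -> reachable F Phi -> reachable F Xi.
Proof.
move=> wk rPhi s n /rPhi[t [m [Ft lenm ts [j ltjm tj]]]].
exists (append t m Xi), m.+1; split.
- apply: derives_append => //; apply: Or44; exists j; split=> //.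
  by rewrite append_last append_lt // tj.
- exact: leqW.
- by move=> i ltin; rewrite append_lt ?ts // (leq_trans ltin).
- by exists m => //; rewrite append_last.
Qed.

Lemma reachable_gmp {V : Type} {R : realType} {F : set (pformula V R)}
    {Phi Psi Xi : pformula V R} :
  gmp Phi Psi Xi -> reachable F Phi -> reachable F Psi -> reachable F Xi.
Proof.
move=> mp rPhi rPsi s n /rPhi[t [m [/rPsi]]].
move=> [u [p [Fu lemp ut [k ltkp uk]]]] lenm ts [j ltjm tj].
have ltjp := leq_trans ltjm lemp.
exists (append u p Xi), p.+1; split.
- apply: derives_append => //; apply: Or43; exists j, k; split=> //.
  by rewrite append_last !append_lt // uk ut // tj.
- exact/leqW/(leq_trans lenm).
- move=> i ltin; have ltim := leq_trans ltin lenm.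
  by rewrite append_lt ?ut ?ts // (leq_trans ltim).
- by exists p => //; rewrite append_last.
Qed.

Lemma derivable_of_reachable {V : Type} {R : realType}
    {F : set (pformula V R)} {Phi : pformula V R} :
  reachable F Phi -> derivable F Phi.
Proof.
move=> rPhi; have [//|t [m [Ft _ _ [i ltim <-]]]] := rPhi (fun=> Phi) 0.
exact: derivable_of_derives Ft ltim.
Qed.

Definition y_cut {V : Type} {R : realType} (F : set (pformula V R)) (y : R) :
    set (formula V) :=
  [set a | exists2 Phi, F Phi & fml Phi = a /\ y <= deg Phi].

Lemma derivable_of_proves {V : Type} {R : realType} {F : set (pformula V R)}
    {g : formula V} {y : {itv R & `]0, 1]}} :
  proves (y_cut F y%:num) g -> derivable F (g, y).
Proof.
move=> Fg; apply: derivable_of_reachable.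
elim: Fg => [a ax|a [Phi FPhi [<- leyPhi]]|a b _ IHa _ IHab].
- apply: (@reachable_weakening _ _ _ (a, widen_itv 1%:itv)).
    by split; rewrite /deg /=.
  by apply: reachable_line => s n sn; apply: Or41; rewrite sn.
- apply: (@reachable_weakening _ _ _ Phi) => //.
  by apply: reachable_line => s n sn; apply: Or42; rewrite sn.
- by apply: reachable_gmp IHa IHab; split=> //; rewrite /deg /= minxx.
Qed.

(** * Possibility concentrated on one valuation *)

(** The bound [x <= 1] absorbs the convention that the infimum of the empty set
    is [1], so that users need not ask whether the formula is a tautology. *)
Lemma le_necessity {V : Type} {R : realType} (pi : possibility V R)
    (a : formula V) (x : R) : x <= 1 ->
  x <= necessity pi a <->
  forall w : Val V, sval w a = false -> x <= 1 - (pi w)%:num.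
Proof.
move=> lex1; rewrite /necessity /inf01; case: ifPn => [/eqP A0|/set0P A0].
  split=> // _ w wa.
  have : set0 (1 - (pi w)%:num) by rewrite -A0; exists w.
  by [].
split=> [lex w wa|lex].
  apply: (le_trans lex); apply: ge_inf; last by exists w.
  by exists 0 => _ [w' _ <-]; rewrite subr_ge0.
by apply: lb_le_inf => // _ [w wa <-]; exact: lex.
Qed.

(** This is where finiteness of the premises matters: the supremum of an
    infinite set of degrees below [y] could be [y] itself. *)
Lemma finite_ubound_lt {R : realType} {A : set R} {y : R} :
  finite_set A -> 0 < y -> (forall x, A x -> x < y) ->
  exists2 m, 0 <= m < y & forall x, A x -> x <= m.
Proof.
move=> /finite_seqP[s ->] y0 sy; exists (\big[Order.max/0]_(x <- s) x).
  apply/andP; split; first exact: bigmax_ge_id.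
  by rewrite big_seq; apply: bigmax_lt => // x /sy.
by move=> x xs; exact: le_bigmax_seq.
Qed.

Definition concentrated {V : Type} {R : realType} (w : Val V) (p : {i01 R}) :
    possibility V R :=
  fun w' => if `[< w' = w >] then p else 0%:i01.

(** A valuation refuting [g] while satisfying the cut would carry a possibility
    distribution that satisfies [F] and gives [g] a necessity below [y]. *)
Lemma entails_cut {V : Type} {R : realType} {F : set (pformula V R)}
    {g : formula V} {y : {itv R & `]0, 1]}} :
  finite_set F -> entails F (g, y) ->
  forall w : Val V, (forall a, y_cut F y%:num a -> sval w a = true) ->
  sval w g = true.
Proof.
move=> finF Fg w wcut; apply: contrapT => /negP/negbTE wg.
pose A := [set deg Phi | Phi in F `&` [set Phi | deg Phi < y%:num]].
have finA : finite_set A by apply: finite_image; exact: finite_setIl.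
(* [m] will be the necessity of every formula that [w] refutes *)
have [//|_ [Phi [_ ltPhi] <-]//|m /andP[m0 ltmy] mA] :=
  finite_ubound_lt (y := y%:num) finA.
have m1 : m <= 1 by apply: le_trans (ltW ltmy) _.
have p0 : 0 <= 1 - m by rewrite subr_ge0.
have p1 : 1 - m <= 1 by rewrite gerBl.
pose pi := concentrated w (Itv01 p0 p1).
suff /Fg : sat_set pi F.
  rewrite /sat /deg le_necessity // => /(_ w wg).
  by rewrite /pi /concentrated asboolT //= subKr leNgt ltmy.
move=> Phi FPhi; rewrite /sat /deg le_necessity // => w' w'Phi.
rewrite /pi /concentrated; case: asboolP => [w'w|_] /=; last by rewrite subr0.
rewrite subKr; apply: mA; exists Phi => //; split=> //=.
rewrite ltNge; apply/negP => leyPhi.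
have /wcut : y_cut F y%:num (fml Phi) by exists Phi.
by rewrite -w'w w'Phi.
Qed.

Theorem theorem6p10 (V : Type) (hV : ([set: V] #= [set: nat])%card) (R : realType)
    (F : set (pformula V R)) (hF : finite_set F)
    (g : formula V) (y : {itv R & `]0, 1]}) :
  entails F (g, y) -> derivable F (g, y).
Proof.
by move=> Fg; apply: derivable_of_proves; apply: proves_complete;
  exact: entails_cut Fg.
Qed.
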